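(* Consider the multi-agent system $\dot x_i(t)=Ax_i(t)+Bu_i(t)$, $i\in\{1,\dots,N\}$, over a connected, structurally balanced signed graph, under the event-triggered protocol $u_i(t)=-K\sum_{j=1}^N|w_{ij}|(\hat x_i(t)-\mathrm{sgn}(w_{ij})\hat x_j(t))$ with control matrix $K\in M_{m\times n}(\mathbb R)$, and with triggering instants $t^i_0=0$, $t^i_{k+1}=\inf\{t>t^i_k: f_i^k(t)>0\}$, where $f_i^k$ is the integral triggering function defined in the context with constants $\beta_i>0$. Then for every $i\in\{1,\dots,N\}$ and $k\in\mathbb N$ we have $t^i_{k+1}>t^i_k$.
   Context: Notation: $\mathbb N$ is the set of nonnegative integers; $\|\cdot\|$ is the Euclidean norm; $A\in M_n(\mathbb R)$, $B\in M_{n\times m}(\mathbb R)$; $x_i(t)\in\mathbb R^n$ and $u_i(t)\in\mathbb R^m$ are the state and control input of agent $i$. Graph: $\mathcal G=(\mathcal V,\mathcal E,\mathcal W)$ is an undirected signed graph with $\mathcal V=\{1,\dots,N\}$ and symmetric signed weight matrix $\mathcal W=(w_{ij})\in M_N(\mathbb R)$, $w_{ij}\ne0$ iff $(j,i)\in\mathcal E$, $w_{ii}=0$. $\mathcal G$ is structurally balanced if there is a bipartition $\mathcal V_1,\mathcal V_2$ of $\mathcal V$ with $w_{ij}\ge0$ for $i,j$ in the same part and $w_{ij}\le 0$ for $i,j$ in different parts. Fix $D=\mathrm{diag}(\sigma_1,\dots,\sigma_N)$, $\sigma_i\in\{1,-1\}$, such that all entries of $D\mathcal WD$ are nonnegative.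 Event-triggered signals: agent $i$ has triggering instants $0=t^i_0\le t^i_1\le t^i_2\le\cdots$. For $t\ge 0$, $\hat x_i(t):=e^{(t-t^i_k)A}x_i(t^i_k)$ where $t^i_k$ is the latest triggering instant of agent $i$ with $t^i_k\le t$. Put $z_i=\sigma_ix_i$, $\hat z_i=\sigma_i\hat x_i$, $e_{z,i}=\hat z_i-z_i$. Triggering rule: let $h:[0,\infty)\to(0,\infty)$ be a fixed continuous function with $\int_0^\infty h(s)\,ds=1$, and let $\beta_i>0$ be constants. Define $$g_i(s)=\|e_{z,i}(s)\|^2-\beta_i\Bigl\|\sum_{j=1}^N|w_{ij}|(\hat z_i(s)-\hat z_j(s))\Bigr\|^2-\beta_ih(s),\qquad f_i^k(t)=\int_{t^i_k}^tg_i(s)\,ds,$$ and $t^i_{k+1}:=\inf\{t>t^i_k: f_i^k(t)>0\}$. Here $f_i^k$ is evaluated along the signals generated with no further triggering of agent $i$ after $t_k^i$ (i.e. $\hat x_i(s)=e^{(s-t^i_k)A}x_i(t^i_k)$ for $s\ge t^i_k$); $\inf\emptyset=+\infty$, in which case agent $i$ has no further triggering instants, and statements about $t^i_k$ concern indices with $t^i_k<\infty$. The states $x_i$ are continuous and satisfy the differential equation between triggering instants, with arbitrary initial states. *)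

(* Defs.v *)
From HB Require Import structures.
From mathcomp Require Import all_boot all_order all_algebra.
From mathcomp Require Import all_classical all_reals all_analysis.

Set Implicit Arguments.
Unset Strict Implicit.
Unset Printing Implicit Defensive.

Import Order.TTheory GRing.Theory Num.Theory.
Import numFieldNormedType.Exports.

Local Open Scope classical_set_scope.
Local Open Scope ring_scope.

(* The library norm on matrices is the sup norm. *)
Definition enorm (R : realType) (n : nat) (v : 'cV[R]_n) : R :=
  Num.sqrt (\sum_(l < n) v l ord0 ^+ 2).

(* The power series of the exponential, summed entry by entry. *)
Definition expmx (R : realType) (n : nat) (M : 'M[R]_n) : 'M[R]_n :=
  \matrix_(a, b)
    limn (series (fun q : nat => (M ^+ q : 'M[R]_n) a b / q`!%:R)).

Section SignedGraph.
Variables (R : realType) (N : nat).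
Implicit Types (W : 'M[R]_N) (sigma : 'I_N -> R).

Definition signed_graph W : Prop := W^T = W /\ forall i, W i i = 0.

Definition edge W : rel 'I_N := [rel i j | W i j != 0].

Definition connected_graph W : Prop := forall i j, connect (edge W) i j.

(* The two parts are V1 and its complement; one of them may be empty. *)
Definition structurally_balanced W : Prop :=
  exists V1 : {set 'I_N}, forall i j : 'I_N,
    ((i \in V1) = (j \in V1) -> 0 <= W i j) /\
    ((i \in V1) <> (j \in V1) -> W i j <= 0).

Definition signature W sigma : Prop :=
  (forall i, sigma i = 1 \/ sigma i = -1) /\
  let D := diag_mx (\row_i sigma i) in
  forall i j, 0 <= (D *m W *m D) i j.

End SignedGraph.

Section EventTriggered.
Variables (R : realType) (N n m : nat).
Variables (A : 'M[R]_n) (B : 'M[R]_(n, m)) (K : 'M[R]_(m, n)) (W : 'M[R]_N).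

(* [tau i k] is the triggering instant t^i_k; it is +oo when agent i triggers
   fewer than k + 1 times. *)
Implicit Types (tau : 'I_N -> nat -> \bar R) (x : 'I_N -> R -> 'cV[R]_n).

(* The latest triggering instant up to s is written as a supremum, so that it
   is meaningful even if the instants of agent i accumulate before s; without
   accumulation the supremum is attained. *)
Definition latest_instant tau (i : 'I_N) (s : R) : R :=
  sup [set r : R | r <= s /\ exists k, tau i k = r%:E].

Definition held_state tau x (i : 'I_N) (s : R) : 'cV[R]_n :=
  let r := latest_instant tau i s in expmx ((s - r) *: A) *m x i r.

Definition control tau x (i : 'I_N) (s : R) : 'cV[R]_m :=
  - (K *m \sum_(j < N) `|W i j| *:
       (held_state tau x i s - Num.sg (W i j) *: held_state tau x j s)).

(* The states x solve the system driven by the protocol with triggering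
   instants tau; "between triggering instants" refers to those of all agents. *)
Definition closed_loop tau x : Prop :=
  (forall i, {within `[0, +oo[, continuous (x i)}) /\
  forall s : R, 0 < s ->
    (\forall r \near s, forall j k, tau j k <> r%:E) ->
    forall (i : 'I_N) (l : 'I_n),
      is_derive s 1 (fun r : R => x i r l ord0)
        ((A *m x i s + B *m control tau x i s) l ord0).

(* The instants of tau without those of agent i of index larger than k. *)
Definition no_more_triggers tau (i : 'I_N) (k : nat) : 'I_N -> nat -> \bar R :=
  fun j l => if (j == i) && (k < l)%N then +oo%E else tau j l.

Variables (sigma beta : 'I_N -> R) (h : R -> R).

Definition trigger_integrand tau x (i : 'I_N) (s : R) : R :=
  let zhat j := sigma j *: held_state tau x j s in
  enorm (zhat i - sigma i *: x i s) ^+ 2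
  - beta i * enorm (\sum_(j < N) `|W i j| *: (zhat i - zhat j)) ^+ 2
  - beta i * h s.

Definition trigger_function tau x (i : 'I_N) (a s : R) : R :=
  (\int[lebesgue_measure]_(r in `[a, s]) trigger_integrand tau x i r)%R.

(* [y] is the evolution without further triggering of agent i after t^i_k, and
   the triggering function is evaluated along it.  The instants of the other
   agents are kept: up to t^i_{k+1} this evolution is the actual one, and the
   infimum depends on it only up to t^i_{k+1} and immediately afterwards.
   If t^i_k = +oo, the set below is empty and t^i_{k+1} = +oo. *)
Definition triggering_rule tau x : Prop :=
  forall (i : 'I_N) (k : nat),
    let tau' := no_more_triggers tau i k in
    exists y : 'I_N -> R -> 'cV[R]_n,
      [/\ closed_loop tau' y,
          (forall j (s : R), 0 <= s -> (s%:E <= tau i k)%E -> y j s = x j s) &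
          tau i k.+1 =
            ereal_inf [set s%:E | s in [set s : R | (tau i k < s%:E)%E /\
                         0 < trigger_function tau' y i (fine (tau i k)) s]]].

End EventTriggered.

(* Main.v *)
Require Import Defs.
From HB Require Import structures.
From mathcomp Require Import all_boot all_order all_algebra.
From mathcomp Require Import all_classical all_reals all_analysis.

Import Order.TTheory GRing.Theory Num.Theory.
Import numFieldNormedType.Exports.

Local Open Scope classical_set_scope.
Local Open Scope ring_scope.

(** A triggering instant a = t^i_k resets the hold error of agent i: on [a, +oo[
    the held state along the evolution y without further triggering of agent i
    is exp((s - a) A) y_i(a), which tends to y_i(a) as s decreases to a, and so
    does y_i(s) by continuity.  So the squared error tends to 0, whereas
    beta_i h(s) tends to beta_i h(a) > 0, and the squared disagreement enters
    the triggering integrand with a negative sign.  Hence the integrand is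
    nonpositive on some [a, a + d[ ([trigger_integrand_le0_near]), and so is its
    integral from a ([Rintegral_le0]): the triggering function cannot become
    positive before a + d, whence t^i_{k+1} >= a + d > a.

    Two points need an argument: that a is the latest instant of agent i at all
    later times, which is where the monotonicity of the instants enters
    ([instant_le], [latest_instant_last]), and the continuity at 0 of the
    exponential, given as an entrywise power series ([expmx_cvg1]).  For the
    latter each entry of the series is dominated by the scalar exponential
    series of the sum of the absolute values of the entries. *)

(** A norm that dominates every row sum of absolute values, so that its powers
    bound the entries of the powers of M. *)
Definition entrysum {R : realType} {n : nat} (M : 'M[R]_n) : R :=
  \sum_(a < n) \sum_(b < n) `|M a b|.

Lemma entrysum_ge0 (R : realType) n (M : 'M[R]_n) : 0 <= entrysum M.
Proof. by apply: sumr_ge0 => a _; apply: sumr_ge0. Qed.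

Lemma entrysumZ (R : realType) n (M : 'M[R]_n) t :
  entrysum (t *: M) = `|t| * entrysum M.
Proof.
rewrite /entrysum mulr_sumr; apply: eq_bigr => a _.
by rewrite mulr_sumr; apply: eq_bigr => b _; rewrite mxE normrM.
Qed.

Lemma normr_mxX_le (R : realType) n (M : 'M[R]_n) q a b :
  `|(M ^+ q : 'M[R]_n) a b| <= entrysum M ^+ q.
Proof.
elim: q a b => [|q IHq] a b.
  by rewrite !expr0 mxE; case: (a == b); rewrite ?normr1 ?normr0.
rewrite !exprS mxE (le_trans (ler_norm_sum _ _ _)) //.
have row_le : \sum_(c < n) `|M a c| <= entrysum M.
  rewrite /entrysum [leRHS](bigD1 a) //= lerDl.
  by apply: sumr_ge0 => c _; apply: sumr_ge0.
apply: le_trans (_ : (\sum_(c < n) `|M a c|) * entrysum M ^+ q <= _).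
  rewrite mulr_suml; apply: ler_sum => c _.
  by rewrite normrM ler_wpM2l.
by rewrite ler_wpM2r// exprn_ge0// entrysum_ge0.
Qed.

Lemma normr_series_sub_head (R : realType) (u v : R ^nat) k :
  (forall q, `|u q| <= v q) ->
  `|series u k.+1 - u 0%N| <= series v k.+1 - v 0%N.
Proof.
move=> uv; rewrite /series /= !big_nat_recl// ![_ 0%N + _]addrC !addrK.
by rewrite (le_trans (ler_norm_sum _ _ _))// ler_sum.
Qed.

(** Both sides are limits of sums without the term of index 0, and the terms on
    the left are dominated by those of the exponential series. *)
Lemma expmx_sub1_le (R : realType) n (M : 'M[R]_n) a b :
  `|expmx M a b - (a == b)%:R| <= expR (entrysum M) - 1.
Proof.
set c := entrysum M.
set u := fun q : nat => (M ^+ q : 'M[R]_n) a b / q`!%:R.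
have u_le q : `|u q| <= exp_coeff c q.
  rewrite /u normrM /exp_coeff /=.
  by rewrite normfV normr_nat ler_wpM2r ?invr_ge0 ?ler0n// normr_mxX_le.
have cvg_exp : cvgn (series (exp_coeff c)) by exact: is_cvg_series_exp_coeff.
have cvg_u : cvgn (series u).
  apply: normed_cvg.
  apply: series_le_cvg cvg_exp => // q; first exact: normr_ge0.
  by apply: le_trans (u_le q); exact: normr_ge0.
have u0 : u 0%N = (a == b)%:R by rewrite /u expr0 mxE fact0 divr1.
rewrite /expmx mxE -/u -u0.
have v0 : exp_coeff c 0%N = 1 by rewrite /exp_coeff /= expr0 fact0 divr1.
have lim_u : (fun k => `|series u k.+1 - u 0%N|) @ \oo -->
    `|limn (series u) - u 0%N|.
  apply: cvg_norm; apply: cvgB; last exact: cvg_cst.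
  by rewrite cvg_shiftS.
have lim_v : (fun k => series (exp_coeff c) k.+1 - 1) @ \oo --> expR c - 1.
  apply: cvgB; last exact: cvg_cst.
  by rewrite cvg_shiftS.
rewrite -(cvg_lim _ lim_u)// -(cvg_lim _ lim_v)//.
apply: ler_lim; [exact: cvgP lim_u|exact: cvgP lim_v|].
by apply: nearW => k; rewrite -v0; apply: normr_series_sub_head.
Qed.

Lemma expmx_cvg1 (R : realType) n (A : 'M[R]_n) (s0 : R) a b :
  expmx ((s - s0) *: A) a b @[s --> s0] --> ((a == b)%:R : R).
Proof.
have bound_cvg : (expR (`|s - s0| * entrysum A) - 1) @[s --> s0] --> (0 : R).
  rewrite -[X in _ --> X](subrr (1 : R)); apply: cvgB; last exact: cvg_cst.
  rewrite -[X in _ --> X]expR0.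
  apply: (continuous_cvg _ (@continuous_expR R 0)).
  rewrite -[X in _ --> X](mul0r (entrysum A)); apply: cvgMr_tmp.
  rewrite -[X in _ --> X](@normr0 _ R^o) -[X in `|X|](subrr s0).
  by apply: cvg_norm; apply: cvgB; [exact: cvg_id|exact: cvg_cst].
apply: (squeeze_cvgr
  (f := fun s => (a == b)%:R - (expR (`|s - s0| * entrysum A) - 1))
  (h := fun s => (a == b)%:R + (expR (`|s - s0| * entrysum A) - 1))).
- by apply: nearW => s; rewrite -ler_distl -entrysumZ expmx_sub1_le.
- by rewrite -[X in _ --> X]subr0; apply: cvgB => //; exact: cvg_cst.
- by rewrite -[X in _ --> X]addr0; apply: cvgD => //; exact: cvg_cst.
Qed.

Lemma enorm_sqr (R : realType) n (v : 'cV[R]_n) :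
  enorm v ^+ 2 = \sum_(l < n) v l ord0 ^+ 2.
Proof. by rewrite /enorm sqr_sqrtr// sumr_ge0// => l _; rewrite sqr_ge0. Qed.

(** A filter finer than the neighbourhoods of s0 is used because at the initial
    time 0 a state is continuous from the right only. *)
Lemma hold_error_cvg0 (R : realType) n (A : 'M[R]_n) (z : R -> 'cV[R]_n)
  (c s0 : R) (F : set_system R) :
  Filter F -> F --> s0 -> z s @[s --> F] --> z s0 ->
  enorm (c *: (expmx ((s - s0) *: A) *m z s0) - c *: z s) ^+ 2 @[s --> F]
    --> (0 : R).
Proof.
move=> filterF F_s0 z_cvg.
have entry_cvg l : (c *: (expmx ((s - s0) *: A) *m z s0) - c *: z s) l ord0
    @[s --> F] --> (0 : R).
  have held_cvg : \sum_(j < n) expmx ((s - s0) *: A) l j * z s0 j ord0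
      @[s --> F] --> \sum_(j < n) (l == j)%:R * z s0 j ord0.
    apply: cvg_big => [|j _]; first exact: add_continuous.
    apply: cvgMr_tmp; apply: (cvg_trans (cvg_app _ F_s0)); exact: expmx_cvg1.
  have sum_eq : \sum_(j < n) (l == j)%:R * z s0 j ord0 = z s0 l ord0.
    rewrite (bigD1 l)//= eqxx mul1r big1 ?addr0// => j.
    by rewrite eq_sym => /negPf ->; rewrite mul0r.
  have z_cvg_l : z s l ord0 @[s --> F] --> z s0 l ord0.
    exact: (continuous_cvg _ (@coord_continuous _ _ _ l ord0 _) z_cvg).
  have : c * (\sum_(j < n) expmx ((s - s0) *: A) l j * z s0 j ord0)
      - c * z s l ord0 @[s --> F] --> c * z s0 l ord0 - c * z s0 l ord0.
    by rewrite -{1}sum_eq; apply: cvgB; exact: cvgMl_tmp.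
  rewrite subrr => err_cvg; under eq_fun do rewrite !mxE.
  exact: err_cvg.
have : \sum_(l < n)
    (c *: (expmx ((s - s0) *: A) *m z s0) - c *: z s) l ord0 ^+ 2
    @[s --> F] --> \sum_(l < n) (0 : R) ^+ 2.
  apply: cvg_big => [|l _]; first exact: add_continuous.
  exact: (continuous_cvg _ (@exprn_continuous R 2 0) (entry_cvg l)).
rewrite big1 => [sum_cvg|l _]; last by rewrite expr0n.
under eq_fun do rewrite enorm_sqr.
exact: sum_cvg.
Qed.

(** The positive part of f vanishes on D, so the extended integral is minus that
    of the negative part; [fine] sends its possible value -oo to 0. *)
Lemma Rintegral_le0 (d : measure_display) (T : measurableType d) (R : realType)
  (mu : {measure set T -> \bar R}) (D : set T) (f : T -> R) :
  (forall t, D t -> f t <= 0) -> (\int[mu]_(t in D) f t)%R <= 0.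
Proof.
move=> f_le0; rewrite /Rintegral fine_le0// integralE.
rewrite (eq_integral (cst 0%E)); last first.
  by apply: le0_funeposE => t /f_le0; rewrite lee_fin.
by rewrite integral0 sub0e oppe_le0; apply: integral_ge0.
Qed.

(** The remaining instants of agent i are t^i_0, ..., t^i_k, so the supremum is
    over a set with largest element t^i_k. *)
Lemma latest_instant_last (R : realType) N (tau : 'I_N -> nat -> \bar R)
  i k (a s : R) :
  (forall l, (l <= k)%N -> (tau i l <= tau i k)%E) -> tau i k = a%:E ->
  a <= s -> latest_instant (no_more_triggers tau i k) i s = a.
Proof.
move=> tau_le tau_a a_le; rewrite /latest_instant; set S := (X in sup X).
have Sa : S a.
  split=> //; exists k.
  by rewrite /no_more_triggers ltnn andbF.
have ubSa : ubound S a.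
  move=> r [_ [l]]; rewrite /no_more_triggers eqxx /=.
  case: ltnP => // lk tau_r.
  by have := tau_le l lk; rewrite tau_r tau_a lee_fin.
apply/eqP; rewrite eq_le; apply/andP; split.
  by apply: ge_sup => //; exists a.
by apply: ub_le_sup => //; exists a.
Qed.

(** Each instant is the infimum of a set of times later than the previous one;
    strictness is lost in the infimum. *)
Lemma instant_le (R : realType) (N n m : nat)
  (A : 'M[R]_n) (B : 'M[R]_(n, m)) (K : 'M[R]_(m, n)) (W : 'M[R]_N)
  (sigma beta : 'I_N -> R) (h : R -> R)
  (tau : 'I_N -> nat -> \bar R) (x : 'I_N -> R -> 'cV[R]_n)
  (i : 'I_N) (l k : nat) :
  triggering_rule A B K W sigma beta h tau x ->
  (l <= k)%N -> (tau i l <= tau i k)%E.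
Proof.
move=> rule; elim: k => [|k IHk]; first by rewrite leqn0 => /eqP ->.
rewrite leq_eqVlt ltnS => /predU1P[->//|/IHk /le_trans]; apply.
have [y [_ _ ->]] := rule i k.
by apply: le_ereal_inf_tmp => _ [s [/ltW tau_s _] <-].
Qed.

(** The hold error at s is small for s near a while beta i * h s stays near
    beta i * h a > 0, and the disagreement term only lowers the integrand.
    The point a itself is included, so that no null set has to be discarded
    when the integrand is integrated from a on. *)
Lemma trigger_integrand_le0_near (R : realType) (N n : nat)
  (A : 'M[R]_n) (W : 'M[R]_N) (sigma beta : 'I_N -> R) (h : R -> R)
  (tau : 'I_N -> nat -> \bar R) (y : 'I_N -> R -> 'cV[R]_n) (i : 'I_N) (a : R) :
  0 <= a -> 0 < beta i -> 0 < h a ->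
  {within `[0, +oo[, continuous h} -> {within `[0, +oo[, continuous (y i)} ->
  (forall s, a <= s -> latest_instant tau i s = a) ->
  \forall s \near within `[a, +oo[ (nbhs a),
    trigger_integrand A W sigma beta h tau y i s <= 0.
Proof.
move=> a0 beta0 ha0 /subspace_continuousP h_cont /subspace_continuousP y_cont.
move=> latest_a; set F := within _ _.
have Da : `[0, +oo[%classic a by rewrite /= in_itv /= a0.
have F_a : F --> a by exact: cvg_within.
have F_D : F --> within `[0, +oo[ (nbhs a).
  apply: within_subset => s; rewrite /= !in_itv /= !andbT; exact: le_trans.
have h_cvg : h s @[s --> F] --> h a.
  exact: (cvg_trans (cvg_app _ F_D) (h_cont a Da)).
have y_cvg : y i s @[s --> F] --> y i a.
  exact: (cvg_trans (cvg_app _ F_D) (y_cont a Da)).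
have err_cvg := hold_error_cvg0 _ _ A _ (sigma i) _ F _ F_a y_cvg.
have gap_cvg : (enorm (sigma i *: (expmx ((s - a) *: A) *m y i a)
    - sigma i *: y i s) ^+ 2 - beta i * h s) @[s --> F] --> 0 - beta i * h a.
  by apply: cvgB; [exact: err_cvg|exact: cvgMl_tmp].
have F_ge : F `[a, +oo[%classic by exact: withinT.
have gap_lt0 : 0 - beta i * h a < 0 by rewrite sub0r oppr_lt0 mulr_gt0.
near=> s.
have a_s : a <= s.
  have : `[a, +oo[%classic s by near: s.
  by rewrite /= in_itv /= andbT.
rewrite /trigger_integrand {1}/held_state latest_a//.
rewrite addrAC lerBlDr add0r.
apply: (@le_trans _ _ 0); last by rewrite mulr_ge0 ?sqr_ge0// ltW.
by near: s; exact: cvgr_le gap_cvg _ gap_lt0.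
Unshelve. all: by end_near. Qed.

Theorem mainTheorem2 (R : realType) (N n m : nat)
  (A : 'M[R]_n) (B : 'M[R]_(n, m)) (K : 'M[R]_(m, n))
  (W : 'M[R]_N) (sigma beta : 'I_N -> R) (h : R -> R)
  (tau : 'I_N -> nat -> \bar R) (x : 'I_N -> R -> 'cV[R]_n)
  (graphW : signed_graph W) (connectedW : connected_graph W)
  (balancedW : structurally_balanced W) (sigmaW : signature W sigma)
  (beta_gt0 : forall i, 0 < beta i)
  (h_cont : {within `[0, +oo[, continuous h})
  (h_gt0 : forall s, 0 <= s -> 0 < h s)
  (h_int : (\int[lebesgue_measure]_(s in `[0%R, +oo[) (h s)%:E = 1)%E)
  (tau0 : forall i, tau i 0%N = 0%E)
  (x_sol : closed_loop A B K W tau x)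
  (tau_rule : triggering_rule A B K W sigma beta h tau x) :
  forall (i : 'I_N) (k : nat),
    (tau i k < +oo)%E -> (tau i k < tau i k.+1)%E.
Proof.
move=> i k tau_lty.
have tau_le l p := instant_le _ _ _ _ _ _ _ _ _ _ _ _ _ i l p tau_rule.
have tau_ge0 : (0 <= tau i k)%E by rewrite -(tau0 i) tau_le.
have [y [[y_cont _] _ ->]] := tau_rule i k.
set a := fine (tau i k).
have tau_a : tau i k = a%:E by rewrite fineK// ge0_fin_numE.
have a0 : 0 <= a by exact: fine_ge0.
have := trigger_integrand_le0_near _ _ _ A W sigma beta h
  (no_more_triggers tau i k) y i a a0 (beta_gt0 i) (h_gt0 a a0) h_cont
  (y_cont i) (fun s => latest_instant_last _ _ _ _ _ _ s (fun l => tau_le l k) tau_a).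
rewrite near_withinE => /nbhs_ballP[d /= d0 ball_le0].
apply: (@lt_le_trans _ _ (a + d)%:E); first by rewrite tau_a lte_fin ltrDl.
apply: le_ereal_inf_tmp => _ [s [_ trigger_gt0] <-].
rewrite lee_fin leNgt; apply/negP => s_lt.
suff : trigger_function A W sigma beta h (no_more_triggers tau i k) y i a s
    <= 0 by rewrite leNgt trigger_gt0.
apply: Rintegral_le0 => r; rewrite /= in_itv /= => /andP[a_r r_s].
apply: ball_le0; last by rewrite /= in_itv /= a_r.
by rewrite /ball /= ler0_norm ?subr_le0// opprB ltrBlDl (le_lt_trans r_s).
Qed.
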